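(* Let $\mathcal H$ be a complex separable infinite-dimensional Hilbert space, let $I=\mathbb N$ or $I=\mathbb Z$, and let $F=(f_n)_{n\in I}$ be a frame for $\mathcal H$ with synthesis operator $U$. Then the following statements are equivalent. (i) $F$ has the form $(T^nf_0)_{n\in I}$ with a bounded operator $T$. (ii) $F$ has the form $(T^nf_0)_{n\in I}$ with a closable operator $T$. (iii) $\ker U$ is $R$-invariant, where $R$ is the right shift on $\ell^2(I)$. In case these equivalent conditions are satisfied, the closure of the generating operator $T$ of $F$ is given by $$\overline T=URU^\dagger,$$ where $U^\dagger=U^*(UU^* )^{-1}$ denotes the pseudo-inverse of $U$.
   Context: $\mathbb N=\{0,1,2,\dots\}$. A frame for $\mathcal H$ is a system $(f_n)_{n\in I}$ for which there are $A,B>0$ with $A\|f\|^2\le\sum_{n\in I}|\langle f,f_n\rangle|^2\le B\|f\|^2$ for all $f\in\mathcal H$. Its synthesis operator is $U:\ell^2(I)\to\mathcal H$, $Uc=\sum_{n\in I}c_nf_n$. The right shift $R$ on $\ell^2(I)$ is $(Rc)_n=c_{n-1}$ (with $(Rc)_0=0$ if $I=\mathbb N$). Let $\mathcal D_F:=\operatorname{span}\{f_n:n\in I\}$ (finite linear combinations). That $F$ has the form $(T^nf_0)_{n\in I}$ with a linear operator $T$ means that there is a linear operator $T$ with domain $\mathcal D_F$ satisfying $Tf_n=f_{n+1}$ for all $n\in I$; this $T$ is unique and maps $\mathcal D_F$ into itself, and it is called the generating operator of $F$. ''Bounded'' and ''closable'' refer to $T$ as an operator $T:\mathcal D_F\to\mathcal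 H$ with $\mathcal D_F$ a (dense) subspace of $\mathcal H$: $T$ is closable if the closure of its graph in $\mathcal H\times\mathcal H$ is the graph of an operator, which is then the closure $\overline T$. *)

(* Defs.v *)
From HB Require Import structures.
From mathcomp Require Import all_boot all_order all_algebra.
From mathcomp Require Import sesquilinear complex finmap.
From mathcomp Require Import all_classical all_reals all_analysis.
From mathcomp Require Import summability.
From mathcomp Require Import ring lra.

Set Implicit Arguments.
Unset Strict Implicit.
Unset Printing Implicit Defensive.

Import Order.TTheory GRing.Theory Num.Theory.
Import numFieldNormedType.Exports.

Local Open Scope classical_set_scope.
Local Open Scope ring_scope.
Local Open Scope complex_scope.

(* The norm of a normed space over R[i] takes its values in R[i]; this is the
   same norm as an element of R. *)
Definition rnorm (R : realType) (V : normedZmodType R[i]) (x : V) : R :=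
  complex.Re `|x|.

(* Library convention: a {dot H for Num.conj} form is linear in its first
   argument and conjugate-linear in the second. A Hilbert space is a complete
   normed module over R[i] whose norm comes from such a form. *)
Definition induces_norm (R : realType) (H : normedModType R[i])
    (dot : {dot H for @Num.conj R[i]}) : Prop :=
  forall x : H, `|x| ^+ 2 = dot x x.

Definition linear_span (K : nzRingType) (V : lmodType K) (A : set V) : set V :=
  [set x | exists (n : nat) (a : 'I_n -> K) (v : 'I_n -> V),
     (forall i, A (v i)) /\ x = \sum_(i < n) a i *: v i].

Definition infinite_dimensional (K : nzRingType) (V : lmodType K) : Prop :=
  forall A : set V, finite_set A -> linear_span A <> [set: V].

Definition separable_space (T : topologicalType) : Prop :=
  exists2 A : set T, countable A & dense A.

Inductive index_set := natIndex | intIndex.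

Definition index_type (I : index_set) : countType :=
  match I with natIndex => nat | intIndex => int end.

Coercion index_type : index_set >-> Countable.type.

Definition next_index (I : index_set) : I -> I :=
  match I with
  | natIndex => fun n : nat => n.+1
  | intIndex => fun n : int => n + 1
  end.

Definition shift_fun (I : index_set) (V : nmodType) : (I -> V) -> I -> V :=
  match I with
  | natIndex => fun (c : nat -> V) (n : nat) => if n is m.+1 then c m else 0
  | intIndex => fun (c : int -> V) (n : int) => c (n - 1)
  end.

Section Ell2.
Variables (R : realType) (I : index_set).

Definition sqnorm2 (c : I -> R[i]) : \bar R :=
  (\esum_(n in [set: I]) (rnorm (c n) ^+ 2)%:E)%E.

Definition square_summable : {pred I -> R[i]} := fun c => (sqnorm2 c < +oo)%E.

Record ell2 := Ell2 {
  ell2_val :> I -> R[i];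
  ell2P : ell2_val \in square_summable }.

HB.instance Definition _ := [isSub for ell2_val].
HB.instance Definition _ := [Choice of ell2 by <:].

Lemma rnormE (z : R[i]) : (rnorm z)%:C = `|z|.
Proof. by rewrite /rnorm RRe_real// normr_real. Qed.

Lemma rnorm_ge0 (z : R[i]) : 0 <= rnorm z.
Proof. by rewrite -lecR rnormE normr_ge0. Qed.

Lemma le_esumZ (T : choiceType) (k : R) (a : T -> \bar R) :
    0 <= k -> (forall n, 0 <= a n)%E ->
  (\esum_(n in [set: T]) (k%:E * a n) <= k%:E * \esum_(n in [set: T]) a n)%E.
Proof.
move=> k0 a0; apply: ge_ereal_sup => _ [A fA <-].
rewrite -ge0_mule_fsumr//; apply: lee_wpmul2l; first by rewrite lee_fin.
by apply: ereal_sup_ubound; exists A.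
Qed.

Lemma square_summable_submod_closed : submod_closed square_summable.
Proof.
split=> [|a u v hu hv]; rewrite unfold_in /square_summable /sqnorm2.
  rewrite esum1 ?ltry// => n _ /=.
  by rewrite /rnorm normr0 expr0n.
pose k : R := 2 * rnorm a ^+ 2 + 2.
have k0 : 0 <= k by rewrite addr_ge0// mulr_ge0// sqr_ge0.
have E0 c n : (0 <= (rnorm (c n : R[i]) ^+ 2)%:E :> \bar R)%E.
  by rewrite lee_fin sqr_ge0.
pose g n := (k%:E * (rnorm (u n) ^+ 2)%:E + k%:E * (rnorm (v n) ^+ 2)%:E)%E.
apply: (@le_lt_trans _ _ (\esum_(n in [set: I]) g n)%E); last first.
  rewrite esumD; [|by move=> i _; rewrite mule_ge0..].
  have fin c : (sqnorm2 c < +oo)%E -> (k%:E * sqnorm2 c < +oo)%E.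
    move=> hc; rewrite lte_mul_pinfty// lee_fin//.
  apply: lte_add_pinfty; (apply: le_lt_trans; first exact: le_esumZ) => //.
    exact: fin.
  exact: fin.
apply: le_esum => n _; rewrite /g -!EFinM -EFinD lee_fin.
have hle : rnorm ((a *: u + v) n) <= rnorm a * rnorm (u n) + rnorm (v n).
  rewrite -lecR rmorphD rmorphM !rnormE -normrM.
  exact: ler_normD.
have sq : rnorm ((a *: u + v) n) ^+ 2 <=
    (rnorm a * rnorm (u n) + rnorm (v n)) ^+ 2.
  by rewrite lerXn2r// nnegrE ?addr_ge0 ?mulr_ge0 ?rnorm_ge0.
apply: (le_trans sq).
rewrite -subr_ge0.
have -> : k * rnorm (u n) ^+ 2 + k * rnorm (v n) ^+ 2
    - (rnorm a * rnorm (u n) + rnorm (v n)) ^+ 2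
  = (rnorm a * rnorm (u n) - rnorm (v n)) ^+ 2
    + 2 * (rnorm a ^+ 2 * rnorm (v n) ^+ 2) + 2 * rnorm (u n) ^+ 2.
  rewrite /k; ring.
apply: addr_ge0; last by apply: mulr_ge0 => //; exact: sqr_ge0.
apply: addr_ge0; first exact: sqr_ge0.
by apply: mulr_ge0 => //; apply: mulr_ge0; exact: sqr_ge0.
Qed.

HB.instance Definition _ := GRing.isSubmodClosed.Build R[i] (I -> R[i])
  square_summable square_summable_submod_closed.
HB.instance Definition _ := [SubChoice_isSubLmodule of ell2 by <:].

Lemma shift_square_summable (c : ell2) : shift_fun c \in square_summable.
Proof.
case: c => c /=; rewrite !unfold_in /square_summable; apply: le_lt_trans.
suff [nextI shiftE shift0] : [/\ injective (@next_index I),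
    forall n, shift_fun c (next_index n) = c n &
    forall n, (forall m, next_index m <> n) -> shift_fun c n = 0].
  have -> : sqnorm2 c = (\esum_(n in range (@next_index I))
      (rnorm (shift_fun c n) ^+ 2)%:E)%E.
    rewrite esum_image; last by move=> x y _ _; exact: nextI.
    by apply: eq_esum => n _; rewrite shiftE.
  rewrite esum_mkcond; apply: le_esum => n _.
  case: ifPn => //; rewrite notin_setE/= => nn; rewrite shift0.
    by rewrite /rnorm normr0 expr0n.
  by move=> m mn; apply: nn; exists m.
case: I c => c /=; split.
- exact: succn_inj.
- by [].
- by case=> // n /(_ n).
- exact: addIr.
- by move=> n; rewrite addrK.
- by move=> n /(_ (n - 1)); rewrite subrK.
Qed.

Definition right_shift (c : ell2) : ell2 := Ell2 (shift_square_summable c).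

Definition ell2_dot (c d : ell2) : R[i] :=
  summability.sum (fun n : I => c n * (d n)^* : R[i]^o).

End Ell2.

(* In the definitions of the adjoint and of the inverse below, the value 0 is
   a default that is used only if no adjoint, resp. no preimage, exists. *)
Definition adjoint (R : realType) (V W : lmodType R[i])
    (dotV : V -> V -> R[i]) (dotW : W -> W -> R[i]) (U : V -> W) (y : W) : V :=
  xget 0 [set x | forall v, dotW (U v) y = dotV v x].

Definition inverse_fun (V W : zmodType) (S : V -> W) : W -> V :=
  'pinv_(fun=> 0) [set: V] S.

(* An operator with domain D is represented by a total function whose values
   outside D are irrelevant. *)
Section PartialOperators.
Variables (R : realType) (H : normedModType R[i]).
Implicit Types (D : set H) (T : H -> H).

Definition linear_operator D T : Prop :=
  [/\ D 0,
      forall (a : R[i]) x y, D x -> D y -> D (a *: x + y) &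
      forall (a : R[i]) x y, D x -> D y -> T (a *: x + y) = a *: T x + T y].

Definition graph D T : set (H * H)%type := [set p | D p.1 /\ p.2 = T p.1].

Definition bounded_operator D T : Prop :=
  exists M : R, forall x, D x -> rnorm (T x) <= M * rnorm x.

Definition is_closure_of D T D' T' : Prop :=
  linear_operator D' T' /\ closure (graph D T) = graph D' T'.

Definition closable D T : Prop := exists D' T', is_closure_of D T D' T'.

End PartialOperators.

Section Frames.
Variables (R : realType) (H : completeNormedModType R[i]).
Variables (dot : {dot H for @Num.conj R[i]}) (I : index_set) (F : I -> H).

Definition is_frame : Prop :=
  exists A B : R, [/\ 0 < A, 0 < B & forall f : H,
    ((A * rnorm f ^+ 2)%:E <= \esum_(n in [set: I]) (rnorm (dot f (F n)) ^+ 2)%:E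
                           <= (B * rnorm f ^+ 2)%:E)%E].

Definition generating_operator (T : H -> H) : Prop :=
  linear_operator (linear_span (range F)) T /\ forall n, T (F n) = F (next_index n).

Definition synthesis (c : ell2 R I) : H :=
  summability.sum (fun n : I => c n *: F n).

Definition ker_synthesis : set (ell2 R I) := [set c | synthesis c = 0].

Definition frame_pinv : H -> ell2 R I :=
  let Ustar := adjoint (@ell2_dot R I) dot synthesis in
  Ustar \o inverse_fun (synthesis \o Ustar).

End Frames.

(* Main.v *)
Require Import Defs.
From mathcomp Require Import all_boot all_order all_algebra.
From mathcomp Require Import sesquilinear complex.
From mathcomp Require Import all_classical all_reals all_analysis.
From mathcomp Require Import finmap summability ring lra.

Import Order.TTheory GRing.Theory Num.Theory.
Import numFieldNormedType.Exports.

Local Open Scope classical_set_scope.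
Local Open Scope ring_scope.
Local Open Scope complex_scope.

(* For c in l^2, truncations c_A of c to finite sets satisfy U c_A -> U c and
   U R c_A -> U R c, and a generating operator T maps U c_A to U R c_A. If
   U c = 0 and (0, y) lies in the closure of the graph of T only for y = 0,
   which holds when T is bounded or closable, then U R c = 0, so ker U is
   R-invariant. Conversely, U U^+ = 1 gives c - U^+ U c in ker U, hence if ker U
   is R-invariant then U R U^+ U c = U R c: the bounded operator U R U^+ is
   linear and sends f_n to f_(n+1), and it is the closure of T by density.
   Invertibility of S = U U^* comes from |f - S f / B|^2 <= (1 - A/B) |f|^2 and
   A |f| <= |S f|. *)

Set Implicit Arguments.
Unset Strict Implicit.

(** * The real-valued norm *)

Section RealNorm.
Variables (R : realType) (V : normedZmodType R[i]).
Implicit Types (x y : V).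

Lemma rnormC x : (rnorm x)%:C = `|x|.
Proof. by rewrite /rnorm RRe_real// normr_real. Qed.

Lemma rnorm_nneg x : 0 <= rnorm x.
Proof. by rewrite -lecR rnormC normr_ge0. Qed.

Lemma ler_rnormD x y : rnorm (x + y) <= rnorm x + rnorm y.
Proof. by rewrite -lecR rmorphD /= !rnormC ler_normD. Qed.

Lemma rnormN x : rnorm (- x) = rnorm x.
Proof. by rewrite /rnorm normrN. Qed.

Lemma rnormB_sym x y : rnorm (x - y) = rnorm (y - x).
Proof. by rewrite /rnorm distrC. Qed.

Lemma rnorm0 : rnorm (0 : V) = 0.
Proof. by rewrite /rnorm normr0. Qed.

Lemma rnorm0_eq0 x : rnorm x = 0 -> x = 0.
Proof. by move=> x0; apply: normr0_eq0; rewrite -rnormC x0. Qed.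

End RealNorm.

(** * Scaling and convergence in the real-valued norm *)

Section RealNormTopology.
Variables (R : realType) (V : normedModType R[i]).
Implicit Types (x y : V).

Lemma rnormZ (a : R[i]) x : rnorm (a *: x) = rnorm a * rnorm x.
Proof. by apply: complexI; rewrite rmorphM /= !rnormC normrZ. Qed.

Lemma gt0_complexE (e : R[i]) : 0 < e -> 0 < complex.Re e /\ e = (complex.Re e)%:C.
Proof. by case: e => a b; rewrite ltcE /= => /andP[/eqP -> ?]. Qed.

Lemma cvg_rnormP {T} {F : set_system T} {FF : Filter F} (f : T -> V) y :
  f @ F --> y <-> forall e : R, 0 < e -> \forall t \near F, rnorm (y - f t) < e.
Proof.
rewrite cvgrPdist_lt; split=> fy e e0.
  have e0' : 0 < e%:C by rewrite ltcR.
  by apply: filterS (fy _ e0') => t; rewrite -rnormC ltcR.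
have [e0' ->] := gt0_complexE e0.
by apply: filterS (fy _ e0') => t; rewrite -rnormC ltcR.
Qed.

End RealNormTopology.

(** * Modulus and real part of complex numbers *)

Lemma rnorm_conj (R : realType) (z : R[i]) : rnorm (z^*)%C = rnorm z.
Proof. by apply: complexI; rewrite !rnormE normcJ. Qed.

Lemma rnorm_sqrE (R : realType) (z : R[i]) : (rnorm z ^+ 2)%:C = z * (z^*)%C.
Proof. by rewrite rmorphXn /= rnormE sqr_normc. Qed.

Lemma Re_le_rnorm (R : realType) (z : R[i]) : complex.Re z <= rnorm z.
Proof.
by rewrite -lecR rnormE (le_trans _ (normc_ge_Re z))// lecR ler_norm.
Qed.

Lemma rnormM (R : realType) (z w : R[i]) : rnorm (z * w) = rnorm z * rnorm w.
Proof. by apply: complexI; rewrite rmorphM /= !rnormE normrM. Qed.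

Lemma rnorm_real (R : realType) (a : R) : 0 <= a -> rnorm (a%:C) = a.
Proof. by move=> a0; apply: complexI; rewrite rnormE ger0_norm// ler0c. Qed.

Lemma ReD (R : realType) (z w : R[i]) :
  complex.Re (z + w) = complex.Re z + complex.Re w.
Proof. by case: z w => [a b] []. Qed.

(** * Inner products and the Cauchy-Schwarz inequality *)

Section InnerProduct.
Variables (R : realType) (H : normedModType R[i]).
Variables (dot : {dot H for @Num.conj R[i]}) (hdot : induces_norm dot).
Implicit Types x y z : H.

Lemma dot_rnorm x : dot x x = (rnorm x ^+ 2)%:C.
Proof. by rewrite -hdot rmorphXn /= rnormC. Qed.

Lemma dot_conj x y : dot x y = ((dot y x)^*)%C.
Proof. by rewrite hermC expr0 mul1r. Qed.

Lemma rnorm_dotC x y : rnorm (dot x y) = rnorm (dot y x).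
Proof. by rewrite dot_conj rnorm_conj. Qed.

Lemma rnormD_sqr x y :
  rnorm (x + y) ^+ 2 = rnorm x ^+ 2 + rnorm y ^+ 2 + 2 * complex.Re (dot x y).
Proof.
apply: complexI; rewrite -dot_rnorm dnormD /= !dot_rnorm.
rewrite !rmorphD /= addcJ; congr (_ + _).
by rewrite rmorphM [X in _ = X * _]rmorph_nat.
Qed.

(** Cauchy-Schwarz: subtracting from [x] its orthogonal projection onto [y] leaves a vector of
    squared norm [|x|^2 - |<x, y>|^2 / |y|^2], which is nonnegative. *)
Lemma rnorm_dot_le x y : rnorm (dot x y) <= rnorm x * rnorm y.
Proof.
have [y0|y0] := eqVneq (rnorm y) 0.
  by rewrite (rnorm0_eq0 y0) linear0r !rnorm0 mulr0.
have ny : 0 < rnorm y ^+ 2 by rewrite exprn_gt0// lt_def y0 rnorm_nneg.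
set a := dot x y; set s := (rnorm y ^+ 2)^-1.
suff : 0 <= rnorm x ^+ 2 - s * rnorm a ^+ 2.
  rewrite subr_ge0 mulrC ler_pdivrMr// -exprMn => h.
  by rewrite -(@ler_pXn2r _ 2)// nnegrE ?mulr_ge0// ?rnorm_nneg// rnorm_ge0.
rewrite (_ : _ - _ = rnorm (x + (- (s%:C * a)) *: y) ^+ 2) ?sqr_ge0//.
rewrite rnormD_sqr rnormZ rnormN rnormM rnorm_real ?invr_ge0 ?sqr_ge0//.
have -> : dot x (- (s%:C * a) *: y) = (- (s * rnorm a ^+ 2))%:C.
  rewrite linearZr_LR /= -/a rmorphN rmorphM /= mulNr -mulrA.
  rewrite (_ : (s%:C^*)%R = s%:C); last exact: conjc_real.
  by rewrite rmorphN rmorphM /= rnorm_sqrE mulrC [a * _]mulrC mulrC.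
(* The occurrences of rnorm a are over distinct convertible instances. *)
pose b := rnorm a; rewrite /= -!/b -[X in s * X * _]/b.
by rewrite /s; field; rewrite y0.
Qed.

End InnerProduct.

(** * Finite sums and sums of nonnegative families *)

Section FiniteSums.
Variables (R : realType) (T : choiceType).
Implicit Types (A B : {fset T}) (f : T -> R).

Lemma partial_sumE (V : zmodType) (x : T -> V) A :
  partial_sum x A = \sum_(i <- A) x i.
Proof. by rewrite /partial_sum big_seq_fsetE. Qed.

Lemma sum_fsetU (V : nmodType) (x : T -> V) A B :
  \sum_(i <- (A `|` B)%fset) x i =
  \sum_(i <- A) x i + \sum_(i <- B | i \notin A) x i.
Proof.
rewrite (bigID (mem A)) /=; congr (_ + _); apply: eq_fbigl_cond => i;
  by rewrite !inE /=; case: (i \in A); rewrite ?andbF ?andbT.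
Qed.

Lemma ler_sum_fset f A B : (forall i, 0 <= f i) -> (A `<=` B)%fset ->
  \sum_(i <- A) f i <= \sum_(i <- B) f i.
Proof.
by move=> f0 AB; rewrite -(fsetUidPr _ _ AB) sum_fsetU lerDl sumr_ge0.
Qed.

Lemma fset_sum_le_esum f A : (forall i, 0 <= f i) ->
  ((\sum_(i <- A) f i)%:E <= \esum_(i in [set: T]) (f i)%:E)%E.
Proof.
move=> f0; apply: esum_ge; exists [set` A]; first by split.
by rewrite -sumEFin -fsbig_seq.
Qed.

Lemma esum_le_fset_sum f (M : R) : (forall A, \sum_(i <- A) f i <= M) ->
  (\esum_(i in [set: T]) (f i)%:E <= M%:E)%E.
Proof.
move=> fM; apply: ge_ereal_sup => _ [A [fA _] <-].
by rewrite fsbig_finite//= sumEFin lee_fin.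
Qed.

(** [A] is a finite set whose sum is within [e] of the supremum; terms outside [A] can then add at
    most [e]. *)
Lemma esum_tail f (e : R) : (forall i, 0 <= f i) ->
    (\esum_(i in [set: T]) (f i)%:E < +oo)%E -> 0 < e ->
  exists A, forall B, \sum_(i <- B | i \notin A) f i <= e.
Proof.
move=> f0 fin e0; set s := (\esum_(i in _) _)%E in fin.
have s0 : (0 <= s)%E by apply: esum_ge0 => i _; rewrite lee_fin.
have sE : s = (fine s)%:E by rewrite fineK// ge0_fin_numE.
have [A hA] : exists A, fine s - e < \sum_(i <- A) f i.
  apply/not_existsP => h.
  have : (s <= (fine s - e)%:E)%E.
    by apply: esum_le_fset_sum => A; rewrite leNgt; apply/negP/h.
  by rewrite {1}sE lee_fin; lra.
exists A => B.
have := fset_sum_le_esum (A `|` B)%fset f0.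
by rewrite -/s sE lee_fin sum_fsetU; lra.
Qed.

End FiniteSums.

(* Unconditional summation along finite index sets *)
#[local] Existing Instance totally_filter.

Section UnconditionalSums.
Variables (R : realType) (T : choiceType).
Implicit Types (A B : {fset T}).

Lemma partial_sum_cvgP (V : normedModType R[i]) (x : T -> V) l :
  partial_sum x @ totally --> l <->
  forall e : R, 0 < e ->
    exists A, forall B, (A `<=` B)%fset -> rnorm (l - \sum_(i <- B) x i) < e.
Proof.
rewrite cvg_rnormP; split=> xl e e0; have := xl e e0.
  by move=> [A _ hA]; exists A => B /hA; rewrite partial_sumE.
by move=> [A hA]; exists A => // B /hA; rewrite partial_sumE.
Qed.

Lemma sum_cvg_eq (V : normedModType R[i]) (x : T -> V) l :
  partial_sum x @ totally --> l -> summability.sum x = l.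
Proof. by move=> xl; apply: cvg_lim xl; exact: norm_hausdorff. Qed.

(** The Cauchy criterion: for [B] containing [A], the two partial sums differ only by terms outside
    [A], and completeness supplies the limit. *)
Lemma summable_of_tail (V : completeNormedModType R[i]) (x : T -> V) :
    (forall e : R, 0 < e ->
      exists A, forall B, rnorm (\sum_(i <- B | i \notin A) x i) < e) ->
  partial_sum x @ totally --> summability.sum x.
Proof.
move=> xe; suff : cvg (partial_sum x @ totally) by [].
apply/cauchy_cvgP; apply: cauchy_exP => e /gt0_complexE[e0 ->].
have [A hA] := xe _ e0; exists (\sum_(i <- A) x i), A => // B AB /=.
rewrite -ball_normE /ball_ /= -rnormC ltcR partial_sumE.
rewrite -(fsetUidPr _ _ AB) sum_fsetU opprD addNKr rnormN; exact: hA.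
Qed.

End UnconditionalSums.

(** Linearity is a plain equation so that the lemma applies to the shift, the synthesis operator and
    coordinate evaluation alike. *)
Lemma linear_fun_sum (K : pzRingType) (V W : lmodType K) (f : V -> W) :
  (forall a x y, f (a *: x + y) = a *: f x + f y) ->
  forall (T : Type) (r : seq T) (a : T -> K) (v : T -> V),
  f (\sum_(i <- r) a i *: v i) = \sum_(i <- r) a i *: f (v i).
Proof.
move=> lf T r a v; elim/big_rec2: _ => [|i y x _ <-]; last by rewrite lf.
(* Linearity at [-1, 0, 0] gives [f 0 = 0]. *)
by have := lf (-1) 0 0; rewrite scaler0 addr0 scaleN1r addNr.
Qed.

(** * The sequence space, its shift and its truncations *)

Section SquareSummable.
Variables (R : realType) (I : index_set).
Implicit Types (c d : ell2 R I) (A B : {fset I}).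

Definition ell2_sqnorm c : R := fine (sqnorm2 c).

Lemma sqnorm2E c : sqnorm2 c = (ell2_sqnorm c)%:E.
Proof.
rewrite fineK// ge0_fin_numE; first exact: (ell2P c).
by apply: esum_ge0 => n _; rewrite lee_fin sqr_ge0.
Qed.

Lemma ell2_sqnorm_ge_fset c A : \sum_(n <- A) rnorm (c n) ^+ 2 <= ell2_sqnorm c.
Proof.
by rewrite -lee_fin -sqnorm2E fset_sum_le_esum// => n; exact: sqr_ge0.
Qed.

Lemma ell2_sqnorm_le c (M : R) :
  (forall A, \sum_(n <- A) rnorm (c n) ^+ 2 <= M) -> ell2_sqnorm c <= M.
Proof. by move=> cM; rewrite -lee_fin -sqnorm2E; exact: esum_le_fset_sum. Qed.

Lemma ell2_sqnorm_ge0 c : 0 <= ell2_sqnorm c.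
Proof. by have := ell2_sqnorm_ge_fset c fset0; rewrite big_seq_fset0. Qed.

Lemma ell2_tail c (e : R) : 0 < e ->
  exists A, forall B, \sum_(n <- B | n \notin A) rnorm (c n) ^+ 2 <= e.
Proof.
by move=> e0; apply: esum_tail => // [n|]; [exact: sqr_ge0|exact: (ell2P c)].
Qed.

Lemma next_index_inj : injective (@next_index I).
Proof. by case: I => /=; [exact: succn_inj|exact: addIr]. Qed.

Lemma shift_fun_next (V : nmodType) (c : I -> V) n :
  shift_fun c (next_index n) = c n.
Proof. by case: I c n => c n //=; rewrite addrK. Qed.

Lemma shift_fun_notin (V : nmodType) (c : I -> V) n :
  (forall m, next_index m <> n) -> shift_fun c n = 0.
Proof.
case: I c n => c n /=; first by case: n => // n /(_ n).
by move=> /(_ (n - 1)); rewrite subrK.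
Qed.

(** Reindexing along the injective successor identifies the sum for [c] with the shifted sum over
    the range; outside the range the shifted entry is 0. *)
Lemma ell2_sqnorm_shift c : ell2_sqnorm (right_shift c) <= ell2_sqnorm c.
Proof.
rewrite -lee_fin -!sqnorm2E /sqnorm2 /=.
rewrite (_ : \esum_(n in _) (rnorm (c n) ^+ 2)%:E =
    \esum_(n in range (@next_index I)) (rnorm (shift_fun c n) ^+ 2)%:E)%E.
  rewrite [leRHS]esum_mkcond; apply: le_esum => n _.
  case: ifPn => //; rewrite notin_setE/= => nn.
  by rewrite shift_fun_notin ?rnorm0 ?expr0n// => m mn; apply: nn; exists m.
rewrite esum_image; last by move=> x y _ _; exact: next_index_inj.
by apply: eq_esum => n _; rewrite shift_fun_next.
Qed.

Lemma right_shift_linear (a : R[i]) c d :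
  right_shift (a *: c + d) = a *: right_shift c + right_shift d.
Proof.
apply: val_inj => /=; case: I c d => c d; apply/funext => n //=.
by case: n => //=; rewrite !fctE /= scaler0 addr0.
Qed.

Lemma delta_square_summable (n : I) :
  (fun m : I => (m == n)%:R : R[i]) \in @square_summable R I.
Proof.
rewrite unfold_in /square_summable /sqnorm2.
apply: (@le_lt_trans _ _ 1%:E); last by rewrite ltry.
apply: esum_le_fset_sum => A; apply: (@le_trans _ _ (\sum_(m <- A) (m == n)%:R)).
  apply: ler_sum => m _; case: (m == n); last by rewrite rnorm0 expr0n.
  by rewrite /rnorm normr1 expr1n.
rewrite -natr_sum lern1 (eq_bigr (fun m => if m == n then 1%N else 0%N)).
  by rewrite -big_mkcond sum1_count count_uniq_mem ?fset_uniq//; case: (_ \in _).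
by move=> m _; case: eqP.
Qed.

Definition ell2_delta (n : I) : ell2 R I := Ell2 (delta_square_summable n).

Lemma right_shift_delta n : right_shift (ell2_delta n) = ell2_delta (next_index n).
Proof.
apply: val_inj => /=; apply/funext => m.
have [[k <-]|/forallNP km] := pselect (exists k, next_index k = m).
  by rewrite shift_fun_next (inj_eq next_index_inj).
rewrite shift_fun_notin//; case: eqP => // mn.
by have := km n; rewrite mn.
Qed.

(** Truncation of [c] to [A], written as a combination of unit vectors so that linear maps pass
    through it. *)
Definition ell2_restr c A : ell2 R I := \sum_(n <- A) c n *: ell2_delta n.

Lemma ell2_restrE c A n : ell2_restr c A n = if n \in A then c n else 0.
Proof.
rewrite /ell2_restr (@linear_fun_sum _ _ (R[i]^o) (fun d : ell2 R I => d n))//.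
have [nA|nA] := boolP (n \in A); last first.
  rewrite big1_fset// => m mA _ /=; case: eqP => [nm|_]; last by rewrite scaler0.
  by rewrite nm mA in nA.
rewrite (big_fsetD1 n)//= eqxx [X in _ + X]big1_fset ?addr0.
  by rewrite /GRing.scale /= mulr1.
by move=> m; rewrite !inE eq_sym => /andP[/negbTE -> _] _; rewrite scaler0.
Qed.

Lemma ell2_restr_dist c (e : R) : 0 < e ->
  exists A, ell2_sqnorm (ell2_restr c A - c) <= e.
Proof.
move=> e0; have [A hA] := ell2_tail c e0; exists A; apply: ell2_sqnorm_le => B.
apply: le_trans (hA B); rewrite [leRHS]big_mkcond /=; apply: ler_sum => n _.
rewrite (_ : (_ - _) n = ell2_restr c A n - c n)// ell2_restrE.
by case: ifP => _; rewrite ?subrr ?rnorm0 ?expr0n// sub0r rnormN.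
Qed.

End SquareSummable.

(** * Synthesis and analysis operators of a Bessel sequence *)

Section Bessel.
Variables (R : realType) (H : completeNormedModType R[i]).
Variables (dot : {dot H for @Num.conj R[i]}) (hdot : induces_norm dot).
Variables (I : index_set) (F : I -> H) (B : R) (B_gt0 : 0 < B).
Hypothesis bessel : forall f : H,
  (\esum_(n in [set: I]) (rnorm (dot f (F n)) ^+ 2)%:E <= (B * rnorm f ^+ 2)%:E)%E.
Implicit Types (c d : ell2 R I) (A : {fset I}) (f g : H).

Local Notation U := (@synthesis R H I F).

Lemma dot_suml (T : Type) (r : seq T) (P : pred T) (x : T -> H) g :
  dot (\sum_(i <- r | P i) x i) g = \sum_(i <- r | P i) dot (x i) g.
Proof.
elim/big_rec2: _ => [|i y x' _ <-]; first by rewrite linear0l.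
by rewrite linearDl.
Qed.

Lemma Re_sum (T : Type) (r : seq T) (P : pred T) (x : T -> R[i]) :
  complex.Re (\sum_(i <- r | P i) x i) = \sum_(i <- r | P i) complex.Re (x i).
Proof. by elim/big_rec2: _ => [//|i y x' _ <-]; rewrite ReD. Qed.

(* The norm of g = sum c_n F_n is absorbed by duality: |g|^2 = <g, g> is at most
   sum |c_n| |<g, F_n>|, and AM-GM bounds this by B/2 sum |c_n|^2 + |g|^2/2. *)
Lemma fset_synthesis_le (c : I -> R[i]) A (P : pred I) :
  rnorm (\sum_(n <- A | P n) c n *: F n) ^+ 2 <=
  B * \sum_(n <- A | P n) rnorm (c n) ^+ 2.
Proof.
set g := \sum_(n <- A | P n) _; set S := \sum_(n <- A | P n) _.
have gg : rnorm g ^+ 2 <= \sum_(n <- A | P n) rnorm (c n) * rnorm (dot g (F n)).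
  have -> : rnorm g ^+ 2 = complex.Re (dot g g) by rewrite (dot_rnorm hdot).
  rewrite {1}/g dot_suml Re_sum; apply: ler_sum => n _.
  by rewrite linearZl_LR (le_trans (Re_le_rnorm _))// rnormM (rnorm_dotC _ g).
pose S' := \sum_(n <- A | P n) rnorm (dot g (F n)) ^+ 2.
have S'g : S' <= B * rnorm g ^+ 2.
  rewrite -lee_fin; apply: le_trans (bessel g).
  apply: le_trans (@fset_sum_le_esum _ _ _ A _); last by move=> n; exact: sqr_ge0.
  rewrite lee_fin /S' big_mkcond; apply: ler_sum => n _.
  by case: ifP => // _; exact: sqr_ge0.
have h : \sum_(n <- A | P n) rnorm (c n) * rnorm (dot g (F n)) <=
    B / 2 * S + (2 * B)^-1 * S'.
  rewrite !mulr_sumr -big_split /=; apply: ler_sum => n _.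
  set x := rnorm (c n); set y := rnorm (dot _ _).
  rewrite -subr_ge0 (_ : _ - _ = (2 * B)^-1 * (B * x - y) ^+ 2).
    by rewrite mulr_ge0 ?sqr_ge0// invr_ge0 mulr_ge0// ltW.
  by field; rewrite gt_eqF.
have h' : (2 * B)^-1 * S' <= rnorm g ^+ 2 / 2.
  by rewrite mulrC ler_pdivrMr ?mulr_gt0//; move: S'g; lra.
lra.
Qed.

(** The finite estimate turns small tails of [c] into small tails of the series. *)
Lemma synthesis_cvg c :
  partial_sum (fun n => c n *: F n) @ totally --> U c.
Proof.
apply: summable_of_tail => e e0.
(* With this tolerance the estimate yields [e^2 / 2], strictly below [e^2]. *)
have e2 : 0 < e ^+ 2 / (2 * B) by rewrite divr_gt0 ?exprn_gt0// mulr_gt0.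
have [A hA] := ell2_tail c e2; exists A => A'.
rewrite -(@ltr_pXn2r _ 2) ?nnegrE ?rnorm_nneg ?(ltW e0)//.
apply: le_lt_trans (fset_synthesis_le _ _ _) _.
apply: (@le_lt_trans _ _ (B * (e ^+ 2 / (2 * B)))); first by rewrite ler_pM2l.
rewrite (_ : B * _ = e ^+ 2 / 2); last by field; rewrite gt_eqF.
by have := exprn_gt0 2 e0; lra.
Qed.

Lemma synthesis_linear (a : R[i]) c d : U (a *: c + d) = a *: U c + U d.
Proof.
apply: (@sum_cvg_eq R I H (fun n => (a *: c + d) n *: F n)).
apply: cvg_trans (cvgD (cvgZr (k := a) (@synthesis_cvg c)) (@synthesis_cvg d)).
apply: near_eq_cvg; near=> A.
transitivity (a *: partial_sum (fun n => c n *: F n) A +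
              partial_sum (fun n => d n *: F n) A) => //.
rewrite !partial_sumE scaler_sumr.
by rewrite -big_split; apply: eq_bigr => n _ /=; rewrite scalerDl scalerA.
Unshelve. all: by end_near. Qed.

Lemma synthesis_le c : rnorm (U c) ^+ 2 <= B * ell2_sqnorm c.
Proof.
set M := B * _; have M0 : 0 <= M by rewrite mulr_ge0 ?ell2_sqnorm_ge0// ltW.
rewrite -[M]sqr_sqrtr// ler_pXn2r// ?nnegrE ?rnorm_nneg ?sqrtr_ge0//.
apply/ler_addgt0Pr => e e0.
have /partial_sum_cvgP/(_ e e0)[A /(_ A (fsubset_refl _)) hA] := @synthesis_cvg c.
set S := \sum_(n <- A) _ in hA.
rewrite -(subrK S (U c)) addrC (le_trans (ler_rnormD _ _))// lerD ?(ltW hA)//.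
rewrite -(@ler_pXn2r _ 2) ?nnegrE ?rnorm_nneg ?sqrtr_ge0// sqr_sqrtr//.
apply: le_trans (fset_synthesis_le _ _ _) _.
by rewrite ler_pM2l// ell2_sqnorm_ge_fset.
Qed.

Lemma synthesis_delta n : U (ell2_delta R n) = F n.
Proof.
rewrite /synthesis; apply: sum_cvg_eq; apply/partial_sum_cvgP => e e0.
exists [fset n]%fset => A.
rewrite fsub1set => nA; rewrite (big_fsetD1 n)//= eqxx scale1r.
rewrite big1_fset ?addr0 ?subrr ?rnorm0//.
by move=> m; rewrite !inE => /andP[/negbTE -> _] _; rewrite scale0r.
Qed.

Lemma synthesis_restr c A : U (ell2_restr c A) = \sum_(n <- A) c n *: F n.
Proof.
rewrite (linear_fun_sum synthesis_linear); apply: eq_bigr => n _.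
by rewrite synthesis_delta.
Qed.

Lemma synthesis_shift_restr c A :
  U (right_shift (ell2_restr c A)) = \sum_(n <- A) c n *: F (next_index n).
Proof.
rewrite (linear_fun_sum (@right_shift_linear R I)) (linear_fun_sum synthesis_linear).
by apply: eq_bigr => n _; rewrite right_shift_delta synthesis_delta.
Qed.

Lemma analysis_square_summable f :
  (fun n : I => dot f (F n)) \in @square_summable R I.
Proof. by rewrite unfold_in; apply: le_lt_trans (bessel f) _; rewrite ltry. Qed.

(** This is [U^*], by [adjoint_synthesis]. *)
Definition analysis f : ell2 R I := Ell2 (analysis_square_summable f).

Lemma analysis_le f : ell2_sqnorm (analysis f) <= B * rnorm f ^+ 2.
Proof. by rewrite -lee_fin -sqnorm2E; exact: bessel. Qed.

Lemma analysis_linear (a : R[i]) f g :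
  analysis (a *: f + g) = a *: analysis f + analysis g.
Proof.
by apply: val_inj; apply/funext => n /=; rewrite linearDl linearZl_LR.
Qed.

Lemma dot_sum_cvg (T : choiceType) (x : T -> H) l g :
  partial_sum x @ totally --> l ->
  partial_sum (fun n => dot (x n) g : R[i]^o) @ totally --> (dot l g : R[i]^o).
Proof.
move=> /partial_sum_cvgP xl; apply/partial_sum_cvgP => e e0.
(* Adding 1 keeps the divisor positive when [g = 0]. *)
have g0 : 0 < rnorm g + 1 by rewrite ltr_wpDl ?rnorm_nneg.
have [A hA] := xl _ (divr_gt0 e0 g0); exists A => A' /hA.
rewrite ltr_pdivlMr// => h; apply: le_lt_trans h.
rewrite -dot_suml -linearBl; apply: le_trans (rnorm_dot_le hdot _ _) _.
by rewrite ler_wpM2l ?rnorm_nneg// lerDl.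
Qed.

(** [analysis f] satisfies the adjoint identity, so the default value of [adjoint] is never taken;
    testing any candidate on unit vectors fixes its coordinates. *)
Lemma adjoint_synthesis f : adjoint (@ell2_dot R I) dot U f = analysis f.
Proof.
have dotU c g : ell2_dot c (analysis g) = dot (U c) g.
  rewrite /ell2_dot (_ : (fun n : I => _) = fun n => dot (c n *: F n) g).
    exact: (sum_cvg_eq (dot_sum_cvg (@synthesis_cvg c))).
  by apply/funext => n; rewrite linearZl_LR /= [dot (F n) g]dot_conj.
have dotl n d : ell2_dot (ell2_delta R n) d = ((d n)^*)%C.
  apply: (@sum_cvg_eq _ _ (R[i]^o)); apply/partial_sum_cvgP => e e0.
  exists [fset n]%fset => A.
  rewrite fsub1set => nA; rewrite (big_fsetD1 n)//= eqxx mul1r.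
  rewrite big1_fset ?addr0 ?subrr ?rnorm0//.
  by move=> m; rewrite !inE => /andP[/negbTE -> _] _; rewrite mul0r.
rewrite /adjoint; case: xgetP => [d _ /= hd|/(_ (analysis f))]; last first.
  by move=> h; exfalso; apply: h => c; rewrite dotU.
apply: val_inj; apply/funext => n /=.
have := hd (ell2_delta R n); rewrite dotl synthesis_delta => /esym.
by move/(congr1 (@conjc R)); rewrite conjcK dot_conj conjcK.
Qed.

(** Termwise the series for [<U U^* f, f>] is [sum |<f, f_n>|^2]; its limit along finite sets is
    matched with the supremum that defines [ell2_sqnorm]. *)
Lemma dot_frame_operator f : dot (U (analysis f)) f = (ell2_sqnorm (analysis f))%:C.
Proof.
have h := dot_sum_cvg (g := f) (@synthesis_cvg (analysis f)).
suff : partial_sum (fun n => dot (analysis f n *: F n) f : R[i]^o) @ totally -->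
    ((ell2_sqnorm (analysis f))%:C : R[i]^o).
  by move=> /sum_cvg_eq <-; rewrite (sum_cvg_eq h).
apply/partial_sum_cvgP => e e0.
(* At most [e / 2] of the total lies outside [A], so the partial sum over any [A'] containing [A] is
   within [e / 2] of it. *)
set c := analysis f; have [A hA] := ell2_tail c (divr_gt0 e0 (ltr0n _ 2)).
exists A => A' AA'; pose x (n : I) := rnorm (c n) ^+ 2.
have x0 n : 0 <= x n by exact: sqr_ge0.
have -> : \sum_(n <- A') (dot (c n *: F n) f : R[i]^o) = (\sum_(n <- A') x n)%:C.
  rewrite rmorph_sum /=; apply: eq_bigr => n _.
  by rewrite /x rnorm_sqrE linearZl_LR /= [dot (F n) f]dot_conj.
have cA' : ell2_sqnorm c <= \sum_(n <- A') x n + e / 2.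
  apply: ell2_sqnorm_le => A''.
  apply: le_trans (ler_sum_fset x0 (fsubsetUr A A'')) _.
  by rewrite sum_fsetU lerD// ler_sum_fset.
have := ell2_sqnorm_ge_fset c A'; rewrite -/(x _) => A'c.
rewrite -rmorphB rnorm_real; last by rewrite subr_ge0.
by move: cA'; lra.
Qed.

End Bessel.

(** * Bounds and surjectivity of the frame operator *)

Section FrameOperator.
Variables (R : realType) (H : completeNormedModType R[i]).
Variables (dot : {dot H for @Num.conj R[i]}) (hdot : induces_norm dot).
Variables (I : index_set) (F : I -> H) (A B : R).
Variables (A_gt0 : 0 < A) (A_le_B : A <= B).
Hypothesis lower_bound : forall f : H,
  ((A * rnorm f ^+ 2)%:E <= \esum_(n in [set: I]) (rnorm (dot f (F n)) ^+ 2)%:E)%E.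
Hypothesis bessel : forall f : H,
  (\esum_(n in [set: I]) (rnorm (dot f (F n)) ^+ 2)%:E <= (B * rnorm f ^+ 2)%:E)%E.
Implicit Types (c d : ell2 R I) (f g x y : H).

Local Notation U := (@synthesis R H I F).
Local Notation analysis := (analysis bessel).
Let B_gt0 : 0 < B := lt_le_trans A_gt0 A_le_B.

Definition frame_operator f : H := U (analysis f).
Local Notation S := frame_operator.
Local Notation energy f := (ell2_sqnorm (analysis f)).

Lemma energy_ge f : A * rnorm f ^+ 2 <= energy f.
Proof. by rewrite -lee_fin -sqnorm2E; exact: lower_bound. Qed.

Lemma energy_le f : energy f <= B * rnorm f ^+ 2.
Proof. exact: analysis_le. Qed.

Lemma frame_operator_linear (a : R[i]) f g : S (a *: f + g) = a *: S f + S g.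
Proof. by rewrite /S analysis_linear (synthesis_linear hdot B_gt0 bessel). Qed.

Lemma frame_operatorB f g : S (f - g) = S f - S g.
Proof. by rewrite addrC -scaleN1r frame_operator_linear scaleN1r addrC. Qed.

Lemma frame_operator_le f : rnorm (S f) ^+ 2 <= B * energy f.
Proof. exact: (synthesis_le hdot B_gt0 bessel). Qed.

Lemma dot_frame_operatorE f : dot (S f) f = (energy f)%:C.
Proof. exact: (dot_frame_operator hdot B_gt0 bessel). Qed.

(** Expanding the square gives [|f|^2 + |S f|^2 / B^2 - 2 <S f, f> / B]; the bound
    [|S f|^2 <= B <S f, f>] cancels one copy of the last term, and [<S f, f> >= A |f|^2] bounds the
    other. *)
Lemma frame_operator_residual f :
  rnorm (f - (B^-1)%:C *: S f) ^+ 2 <= (1 - A / B) * rnorm f ^+ 2.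
Proof.
rewrite (rnormD_sqr hdot) rnormN rnormZ rnorm_real ?invr_ge0 ?(ltW B_gt0)//.
have -> : dot f (- ((B^-1)%:C *: S f)) = (- (B^-1 * energy f))%:C.
  rewrite linearNr linearZr_LR /= [dot f (S f)]dot_conj dot_frame_operatorE.
  rewrite (_ : Num.conj (B^-1)%:C = (B^-1)%:C); last exact: conjc_real.
  by rewrite conjc_real -rmorphM -rmorphN.
have h1 : (B^-1 * rnorm (S f)) ^+ 2 <= B^-1 * energy f.
  rewrite exprMn; apply: (@le_trans _ _ (B^-1 ^+ 2 * (B * energy f))).
    by rewrite ler_wpM2l ?sqr_ge0// frame_operator_le.
  by rewrite mulrA expr2 -[_ * _ * B]mulrA mulVf ?mulr1// gt_eqF.
have h2 : A / B * rnorm f ^+ 2 <= B^-1 * energy f.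
  by rewrite mulrAC mulrC ler_wpM2l ?invr_ge0 ?(ltW B_gt0)// energy_ge.
by move: h1 h2 => /=; lra.
Qed.

(** Combines [0 <= (|S f| - A |f|)^2] with [A |f|^2 <= energy f <= |S f| |f|]. It later bounds the
    norm of the pseudo-inverse. *)
Lemma frame_operator_energy f : A * energy f <= rnorm (S f) ^+ 2.
Proof.
have h : energy f <= rnorm (S f) * rnorm f.
  apply: le_trans (rnorm_dot_le hdot _ _); rewrite dot_frame_operatorE.
  by rewrite rnorm_real// ell2_sqnorm_ge0.
have h1 : 0 <= (rnorm (S f) - A * rnorm f) ^+ 2 by exact: sqr_ge0.
have h2 : A * (A * rnorm f ^+ 2) <= A * energy f by rewrite ler_pM2l// energy_ge.
have h3 : A * energy f <= A * (rnorm (S f) * rnorm f) by rewrite ler_pM2l.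
by move: h1 h2 h3; lra.
Qed.

Lemma frame_operator_ge f : A * rnorm f <= rnorm (S f).
Proof.
rewrite -(@ler_pXn2r _ 2) ?nnegrE ?mulr_ge0 ?rnorm_nneg ?(ltW A_gt0)// exprMn.
by rewrite expr2 -mulrA (le_trans _ (frame_operator_energy f))// ler_pM2l// energy_ge.
Qed.

Lemma frame_operator_bounded f : rnorm (S f) <= B * rnorm f.
Proof.
rewrite -(@ler_pXn2r _ 2) ?nnegrE ?mulr_ge0 ?rnorm_nneg ?(ltW B_gt0)// exprMn.
by rewrite expr2 -mulrA (le_trans (frame_operator_le f))// ler_pM2l// energy_le.
Qed.

(** Richardson iteration: the update [x + B^-1 (y - S x)] replaces the residual [r = y - S x] by
    [r - B^-1 S r], whose squared norm is at most [q |r|^2]. *)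
Lemma frame_operator_dense y (e : R) : 0 < e -> exists x, rnorm (y - S x) < e.
Proof.
move=> e0; pose q := 1 - A / B.
have q0 : 0 <= q by rewrite subr_ge0 ler_pdivrMr ?mul1r.
have q1 : q < 1 by rewrite gtrBl divr_gt0.
have step k : exists x, rnorm (y - S x) ^+ 2 <= q ^+ k * rnorm y ^+ 2.
  elim: k => [|k [x hx]].
    (* The start is the zero vector, written [y - y] so that [frame_operatorB] evaluates [S]
       there. *)
    by exists (y - y); rewrite frame_operatorB subrr subr0 expr0 mul1r.
  exists (x + (B^-1)%:C *: (y - S x)).
  rewrite [x + _]addrC frame_operator_linear [_ + S x]addrC opprD addrA.
  apply: le_trans (frame_operator_residual _) _.
  by rewrite [q ^+ _]exprS -mulrA ler_wpM2l.
have y1 : 0 < rnorm y ^+ 2 + 1 by rewrite ltr_wpDl ?sqr_ge0.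
have : (fun k => q ^+ k) @ \oo --> (0 : R) by apply: cvg_expr; rewrite ger0_norm.
move=> /cvgrPdist_lt/(_ _ (divr_gt0 (exprn_gt0 2 e0) y1))[k _ /(_ k (leqnn k))] /=.
rewrite sub0r normrN ger0_norm ?exprn_ge0// ltr_pdivlMr// => hk.
have [x hx] := step k; exists x.
rewrite -(@ltr_pXn2r _ 2) ?nnegrE ?rnorm_nneg ?(ltW e0)//.
by apply: le_lt_trans hx _; apply: le_lt_trans hk; rewrite ler_wpM2l ?exprn_ge0// lerDl.
Qed.

(** The sets of approximate solutions [|y - S x| < e] generate a filter: proper by density of the
    range, Cauchy by [A |x| <= |S x|], and its limit solves the equation since [S] is bounded. *)
Lemma frame_operator_surj y : exists x, S x = y.
Proof.
pose G : set_system H :=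
  filter_from [set e : R | 0 < e] (fun e => [set x | rnorm (y - S x) < e]).
have PG : ProperFilter G.
  apply: filter_from_proper => [|e e0]; last exact: frame_operator_dense.
  apply: filter_from_filter; first by exists 1 => /=.
  move=> e1 e2 /= e10 e20; exists (Num.min e1 e2); first by rewrite /= lt_min e10.
  by move=> x /=; rewrite lt_min => /andP[].
have /cauchy_cvgP/cvg_ex[x Gx] : cauchy G.
  apply: cauchy_exP => e /gt0_complexE[e0 ->]; set r := complex.Re e in e0 *.
  (* Two points with residuals below [A r / 2] have images within [A r], hence are themselves within
     [r]. *)
  have d0 : 0 < A * r / 2 by rewrite divr_gt0// mulr_gt0.
  have [x0 hx0] := frame_operator_dense y d0; exists x0, (A * r / 2) => // x /= hx.
  rewrite -ball_normE /ball_ /= -rnormC ltcR -(ltr_pM2l A_gt0).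
  apply: le_lt_trans (frame_operator_ge _) _; rewrite frame_operatorB.
  rewrite -[S x0](subrK y) -addrA; apply: le_lt_trans (ler_rnormD _ _) _.
  by rewrite rnormB_sym; move: hx hx0; lra.
exists x; apply/esym/eqP; rewrite -subr_eq0; apply/eqP/rnorm0_eq0/le_anti.
rewrite rnorm_nneg andbT; apply/ler_addgt0Pr => e e0; rewrite add0r.
have e2 : 0 < e / 2 by rewrite divr_gt0.
have Gx' : id @ G --> x by [].
(* Half of [e] goes to [|y - S z|] and half to [|S (z - x)| <= B |z - x|], hence the radius
   [e / 2 / B]. *)
have /cvg_rnormP/(_ _ (divr_gt0 e2 B_gt0)) h1 := Gx'.
have h2 : G [set z | rnorm (y - S z) < e / 2] by exists (e / 2).
have [z [/= xz yz]] := filter_ex (filterI h1 h2).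
rewrite -[y](subrK (S z)) -addrA -frame_operatorB.
apply: le_trans (ler_rnormD _ _) _; have := frame_operator_bounded (z - x).
rewrite rnormB_sym in xz; move: xz yz; rewrite ltr_pdivlMr// mulrC; lra.
Qed.

End FrameOperator.

(** * Operators on subspaces and closures of their graphs *)

Section LinearOperators.
Variables (R : realType) (H : normedModType R[i]).
Implicit Types (D : set H) (T : H -> H).

Lemma linear_operator_sum D T (I : Type) (r : seq I) (a : I -> R[i]) (v : I -> H) :
    linear_operator D T -> (forall i, D (v i)) ->
  D (\sum_(i <- r) a i *: v i) /\
  T (\sum_(i <- r) a i *: v i) = \sum_(i <- r) a i *: T (v i).
Proof.
move=> [D0 DL TL] Dv; elim: r => [|i r [Dr Tr]].
  rewrite !big_nil; split=> //.
  by have := TL (-1) 0 0 D0 D0; rewrite scaler0 addr0 scaleN1r addNr.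
by rewrite !big_cons TL// Tr; split=> //; exact: DL.
Qed.

Lemma linear_operator_span (A : set H) T :
    (forall (a : R[i]) x y, T (a *: x + y) = a *: T x + T y) ->
  linear_operator (linear_span A) T.
Proof.
move=> TL; split=> [|a x y|//].
  exists 0, (fun=> 0), (fun=> 0); rewrite big_ord0; split=> //; case=> //.
move=> [m [b [v [Av ->]]]] [n [c [w [Aw ->]]]].
(* Combinations of lengths [m] and [n] are concatenated, with [split] sorting the indices. *)
exists (m + n)%N.
exists (fun i => match fintype.split i with inl j => a * b j | inr j => c j end).
exists (fun i => match fintype.split i with inl j => v j | inr j => w j end); split.
  by move=> i; case: fintype.split.
rewrite big_split_ord scaler_sumr; congr (_ + _); apply: eq_bigr => i _.
  by rewrite (unsplitK (inl i)) scalerA.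
by rewrite (unsplitK (inr i)).
Qed.

Lemma mem_linear_span (A : set H) x : A x -> linear_span A x.
Proof. by exists 1, (fun=> 1), (fun=> x); rewrite big_ord1 scale1r. Qed.

Lemma nbhs_rnormP (x : H) (P : set H) :
  nbhs x P <-> exists2 e : R, 0 < e & forall z, rnorm (x - z) < e -> P z.
Proof.
split=> [/nbhs_normP[e /gt0_complexE[e0 eE] h]|[e e0 h]].
  by exists (complex.Re e) => // z; rewrite -ltcR rnormC -eE; exact: h.
apply/nbhs_normP; exists e%:C; first by rewrite /= ltcR.
by move=> z; rewrite /ball_ /= -rnormC ltcR; exact: h.
Qed.

Lemma closure_graphP D T (p : H * H) : closure (graph D T) p <->
  forall e : R, 0 < e ->
    exists x, [/\ D x, rnorm (p.1 - x) < e & rnorm (p.2 - T x) < e].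
Proof.
case: p => x y /=; split=> [cl e e0|h P].
  have [|[z _] [[/= Dz ->] [xz yz]]] :=
      cl [set q | rnorm (x - q.1) < e /\ rnorm (y - q.2) < e].
    exists ([set z | rnorm (x - z) < e], [set z | rnorm (y - z) < e]) => //.
    by split; apply/nbhs_rnormP; exists e.
  by exists z.
move=> [[P1 P2] /= [/nbhs_rnormP[e1 e10 h1] /nbhs_rnormP[e2 e20 h2]] P12].
have [|z [Dz xz yz]] := h (Num.min e1 e2); first by rewrite lt_min e10.
rewrite lt_min in xz; rewrite lt_min in yz.
exists (z, T z); split=> //; apply: P12; split => /=.
  by apply: h1; case/andP: xz.
by apply: h2; case/andP: yz.
Qed.

Lemma bounded_closure_graph0 D T y :
  bounded_operator D T -> closure (graph D T) (0, y) -> y = 0.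
Proof.
move=> [M TM] /closure_graphP /= cl; apply/rnorm0_eq0/le_anti.
rewrite rnorm_nneg andbT; apply/ler_addgt0Pr => e e0; rewrite add0r.
(* The divisor [1 + |M|], positive for every [M], splits [e] into one share for [|y - T x|] and
   [|M|] shares for [|T x|]. *)
have M0 : 0 < 1 + `|M| by rewrite ltr_wpDr.
have [x [Dx]] := cl _ (divr_gt0 e0 M0).
rewrite sub0r rnormN => hx hy; rewrite -[y](subrK (T x)).
apply: le_trans (ler_rnormD _ _) _.
have h1 : rnorm (T x) <= `|M| * rnorm x.
  by rewrite (le_trans (TM _ Dx))// ler_wpM2r ?rnorm_nneg// ler_norm.
have h2 : `|M| * rnorm x <= `|M| * (e / (1 + `|M|)) by rewrite ler_wpM2l// ltW.
have : e = e / (1 + `|M|) + `|M| * (e / (1 + `|M|)).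
  by field; rewrite gt_eqF.
by move: hy h1 h2; lra.
Qed.

(** The closure is the graph of a linear operator, whose value at 0 is 0. *)
Lemma closable_closure_graph0 D T y :
  closable D T -> closure (graph D T) (0, y) -> y = 0.
Proof.
move=> [D' [T' [[D0 _ TL] ->]]] [_ /= ->].
by have := TL (-1) 0 0 D0 D0; rewrite scaler0 addr0 scaleN1r addNr.
Qed.

End LinearOperators.

(** * Generating operators and the shift *)

Section OrbitFrames.
Variables (R : realType) (H : completeNormedModType R[i]).
Variables (dot : {dot H for @Num.conj R[i]}) (hdot : induces_norm dot).
Variables (I : index_set) (F : I -> H) (A B : R).
Variables (A_gt0 : 0 < A) (A_le_B : A <= B).
Hypothesis lower_bound : forall f : H,
  ((A * rnorm f ^+ 2)%:E <= \esum_(n in [set: I]) (rnorm (dot f (F n)) ^+ 2)%:E)%E.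
Hypothesis bessel : forall f : H,
  (\esum_(n in [set: I]) (rnorm (dot f (F n)) ^+ 2)%:E <= (B * rnorm f ^+ 2)%:E)%E.
Implicit Types (c d : ell2 R I) (f g x y : H) (T : H -> H).

Local Notation U := (@synthesis R H I F).
Local Notation shift := (@right_shift R I).
Local Notation pinv := (frame_pinv dot F).
Local Notation D := (linear_span (range F)).
Let B_gt0 : 0 < B := lt_le_trans A_gt0 A_le_B.
Let U_linear := synthesis_linear hdot B_gt0 bessel.
Let U_le := synthesis_le hdot B_gt0 bessel.

Lemma synthesisB c d : U (c - d) = U c - U d.
Proof. by rewrite addrC -scaleN1r U_linear scaleN1r addrC. Qed.

Lemma right_shiftB c d : shift (c - d) = shift c - shift d.
Proof. by rewrite addrC -scaleN1r right_shift_linear scaleN1r addrC. Qed.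

(** Surjectivity of [U U^*] ensures that [inverse_fun] returns a genuine preimage, never its
    default. *)
Lemma synthesis_pinv x : U (pinv x) = x.
Proof.
pose S := U \o adjoint (@ell2_dot R I) dot U.
have surjS : set_surj [set: H] [set: H] S.
  move=> y _; have [z zy] := frame_operator_surj hdot A_gt0 A_le_B lower_bound bessel y.
  by exists z => //; rewrite /S /= (adjoint_synthesis hdot B_gt0 bessel).
exact: (surjpK (fun=> 0) surjS (in_setT x)).
Qed.

(** [pinv x] is [U^* z] with [S z = x], so this is [frame_operator_energy] at [z]. *)
Lemma ell2_sqnorm_pinv x : A * ell2_sqnorm (pinv x) <= rnorm x ^+ 2.
Proof.
rewrite -[in leRHS](synthesis_pinv x) /frame_pinv /=.
rewrite (adjoint_synthesis hdot B_gt0 bessel).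
exact: frame_operator_energy.
Qed.

Lemma synthesis_shift_le c : rnorm (U (shift c)) ^+ 2 <= B * ell2_sqnorm c.
Proof. by rewrite (le_trans (U_le _))// ler_pM2l// ell2_sqnorm_shift. Qed.

(** The squared norm carries a factor [B / A]; the constant [1 + B / A] dominates its square root
    without introducing one. *)
Lemma synthesis_shift_pinv_le x :
  rnorm (U (shift (pinv x))) <= (1 + B / A) * rnorm x.
Proof.
have BA0 : 0 <= B / A by rewrite divr_ge0// ltW.
rewrite -(@ler_pXn2r _ 2) ?nnegrE ?mulr_ge0 ?rnorm_nneg ?addr_ge0// exprMn.
apply: le_trans (synthesis_shift_le _) _.
apply: (@le_trans _ _ (B / A * rnorm x ^+ 2)).
  by rewrite -mulrA ler_pM2l// mulrC ler_pdivlMr// mulrC ell2_sqnorm_pinv.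
rewrite ler_wpM2r ?sqr_ge0// -subr_ge0.
rewrite (_ : _ - _ = 1 + B / A + (B / A) ^+ 2); last by ring.
by rewrite !addr_ge0 ?sqr_ge0.
Qed.

(** One truncation serves both approximations because the shift does not increase the norm of the
    error [ell2_restr c A' - c]. *)
Lemma ell2_restr_approx c (e : R) : 0 < e -> exists A' : {fset I},
  rnorm (U c - U (ell2_restr c A')) < e /\
  rnorm (U (shift c) - U (shift (ell2_restr c A'))) < e.
Proof.
move=> e0; have e2 : 0 < e ^+ 2 / (2 * B) by rewrite divr_gt0 ?exprn_gt0// mulr_gt0.
have [A' hA] := ell2_restr_dist c e2; exists A'.
have lt_e (z : H) : rnorm z ^+ 2 <= B * ell2_sqnorm (ell2_restr c A' - c) ->
      rnorm z < e.
  move=> hz; rewrite -(@ltr_pXn2r _ 2) ?nnegrE ?rnorm_nneg ?(ltW e0)//.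
  apply: le_lt_trans hz _; apply: (@le_lt_trans _ _ (B * (e ^+ 2 / (2 * B)))).
    by rewrite ler_pM2l.
  rewrite (_ : B * _ = e ^+ 2 / 2); last by field; rewrite gt_eqF.
  by have := exprn_gt0 2 e0; lra.
rewrite (rnormB_sym (U c)) (rnormB_sym (U (shift c))) -!synthesisB -right_shiftB.
by split; apply: lt_e; [exact: U_le|exact: synthesis_shift_le].
Qed.

Lemma span_fset_sum (A' : {fset I}) (a : I -> R[i]) : D (\sum_(n <- A') a n *: F n).
Proof.
have DL : linear_operator D (fun x => x) by exact: linear_operator_span.
have DF n : D (F n) by apply: mem_linear_span; exists n.
by have [] := linear_operator_sum A' a DL DF.
Qed.

Lemma generating_operator_restr T c (A' : {fset I}) :
  generating_operator F T -> T (U (ell2_restr c A')) = U (shift (ell2_restr c A')).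
Proof.
move=> [TL TF]; have DF n : D (F n) by apply: mem_linear_span; exists n.
rewrite (synthesis_restr hdot B_gt0 bessel) (synthesis_shift_restr hdot B_gt0 bessel).
have [_ ->] := linear_operator_sum A' c TL DF.
by apply: eq_bigr => n _; rewrite TF.
Qed.

(** Graph points of [T] over truncations of [c] converge to [(U c, U R c) = (0, U R c)]. The
    hypothesis on the closure is a common consequence of boundedness and closability. *)
Lemma ker_synthesis_shift T : generating_operator F T ->
    (forall y, closure (graph D T) (0, y) -> y = 0) ->
  shift @` ker_synthesis F `<=` ker_synthesis F.
Proof.
move=> TF T0 _ [c c0 <-]; apply: T0; apply/closure_graphP => e e0 /=.
have [A' [h1 h2]] := ell2_restr_approx c e0.
exists (U (ell2_restr c A')); split.
- by rewrite (synthesis_restr hdot B_gt0 bessel); exact: span_fset_sum.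
- by rewrite -[0]c0.
- by rewrite generating_operator_restr.
Qed.

(** * The operator [U R U^+] for an invariant kernel *)

Section ShiftInvariantKernel.
Hypothesis ker_shift : shift @` ker_synthesis F `<=` ker_synthesis F.
Local Notation T' := (U \o shift \o pinv).

Lemma shift_pinv_synthesis c : T' (U c) = U (shift c).
Proof.
apply/eqP; rewrite -subr_eq0 /= -synthesisB -right_shiftB; apply/eqP.
apply: ker_shift; exists (pinv (U c) - c) => //.
by rewrite /ker_synthesis /= synthesisB synthesis_pinv subrr.
Qed.

(** Writing each vector as a synthesis reduces the claim to linearity of [U] and of the shift, with
    no appeal to linearity of [pinv]. *)
Lemma shift_pinv_linear (a : R[i]) x y : T' (a *: x + y) = a *: T' x + T' y.
Proof.
rewrite -[x]synthesis_pinv -[y]synthesis_pinv -U_linear !shift_pinv_synthesis.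
by rewrite right_shift_linear U_linear.
Qed.

Lemma shift_pinv_frame n : T' (F n) = F (next_index n).
Proof.
rewrite -(synthesis_delta (R := R)) shift_pinv_synthesis right_shift_delta.
exact: synthesis_delta.
Qed.

Lemma shift_pinv_generating : generating_operator F T'.
Proof.
by split; [exact: linear_operator_span shift_pinv_linear|exact: shift_pinv_frame].
Qed.

Lemma generating_operator_eq T x : generating_operator F T -> D x -> T x = T' x.
Proof.
move=> [TL TF] [n [a [v [Fv ->]]]].
have Dv i : D (v i) by exact: mem_linear_span.
have [_ ->] := linear_operator_sum (index_enum 'I_n) a TL Dv.
have [_ ->] := linear_operator_sum (index_enum 'I_n) a shift_pinv_generating.1 Dv.
apply: eq_bigr => i _; have [m _ <-] := Fv i.
by rewrite TF shift_pinv_frame.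
Qed.

(** Limits of graph points of [T] lie on the graph of [T'] because [T'] is bounded; conversely,
    truncations of [pinv x] approximate [(x, T' x)] by graph points of [T]. *)
Lemma generating_operator_closure T : generating_operator F T ->
  is_closure_of D T [set: H] T'.
Proof.
move=> TF; split.
  by split=> // a x y _ _; exact: shift_pinv_linear.
apply/seteqP; split=> [[x y] /closure_graphP /= cl|[x _] [_ /= ->]].
  split=> //=; apply/eqP; rewrite -subr_eq0; apply/eqP/rnorm0_eq0/le_anti.
  rewrite rnorm_nneg andbT; apply/ler_addgt0Pr => e e0; rewrite add0r.
  (* As [T z = T' z] on the span, [|y - T' x|] is at most [|y - T z| + (1 + B / A) |z - x|]; this
     divisor keeps the total below [e]. *)
  have M0 : 0 < 1 + (1 + B / A) by rewrite !addr_gt0 ?divr_gt0.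
  have [z [Dz xz yz]] := cl _ (divr_gt0 e0 M0).
  rewrite (generating_operator_eq TF Dz) in yz.
  rewrite -[y](subrK (T' z)) -addrA; apply: le_trans (ler_rnormD _ _) _.
  have -> : T' z - U (shift (pinv x)) = T' (z - x).
    by rewrite [z - x]addrC -[- x]scaleN1r shift_pinv_linear scaleN1r addrC.
  have h := synthesis_shift_pinv_le (z - x); rewrite rnormB_sym in xz.
  have h2 : (1 + B / A) * rnorm (z - x) <= (1 + B / A) * (e / (1 + (1 + B / A))).
    by rewrite ler_wpM2l ?ltW// addr_gt0 ?divr_gt0.
  have : e = e / (1 + (1 + B / A)) + (1 + B / A) * (e / (1 + (1 + B / A))).
    by field; rewrite !gt_eqF// addr_gt0// addr_gt0.
  by move: yz h h2 => /=; lra.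
apply/closure_graphP => e e0 /=.
have [A' [h1 h2]] := ell2_restr_approx (pinv x) e0.
exists (U (ell2_restr (pinv x) A')); split.
- by rewrite (synthesis_restr hdot B_gt0 bessel); exact: span_fset_sum.
- by rewrite -{1}[x]synthesis_pinv.
- by rewrite generating_operator_restr.
Qed.

End ShiftInvariantKernel.
End OrbitFrames.

(** * The equivalence and the closure formula *)

Unset Implicit Arguments.

Theorem theorem2p3 (R : realType) (H : completeNormedModType R[i])
    (dot : {dot H for @Num.conj R[i]}) (hdot : induces_norm dot)
    (hsep : separable_space H) (hinf : infinite_dimensional H)
    (I : index_set) (F : I -> H) (hF : is_frame dot F) :
  [<-> exists2 T : H -> H,
         generating_operator F T & bounded_operator (linear_span (range F)) T;
       exists2 T : H -> H,
         generating_operator F T & closable (linear_span (range F)) T;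
       @right_shift R I @` ker_synthesis F `<=` ker_synthesis F]
  /\ (@right_shift R I @` ker_synthesis F `<=` ker_synthesis F ->
      forall T : H -> H, generating_operator F T ->
      is_closure_of (linear_span (range F)) T
        [set: H] (synthesis F \o @right_shift R I \o frame_pinv dot F)).
Proof.
have [A [B [A0 B0 AB]]] := hF.
(* With [A + B] as upper bound, the two bounds are ordered without exhibiting a nonzero vector. *)
have AAB : A <= A + B by rewrite lerDl ltW.
have lo f : ((A * rnorm f ^+ 2)%:E <=
    \esum_(n in [set: I]) (rnorm (dot f (F n)) ^+ 2)%:E)%E by have /andP[] := AB f.
have up f : (\esum_(n in [set: I]) (rnorm (dot f (F n)) ^+ 2)%:E <=
    ((A + B) * rnorm f ^+ 2)%:E)%E.
  have /andP[_ /le_trans] := AB f; apply.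
  by rewrite lee_fin ler_wpM2r ?sqr_ge0// lerDr ltW.
have closureT := generating_operator_closure hdot A0 AAB lo up.
have kerT := ker_synthesis_shift hdot A0 AAB up.
split=> //; tfae.
(* Boundedness first yields an invariant kernel; the explicit closure then witnesses closability. *)
- move=> [T TF Tb]; exists T => //; do 2!eexists; apply: closureT => //.
  by apply: kerT TF _ => y; exact: bounded_closure_graph0.
- by move=> [T TF Tc]; apply: kerT TF _ => y; exact: closable_closure_graph0.
move=> kerF; eexists; first exact: (shift_pinv_generating hdot A0 AAB lo up).
by exists (1 + (A + B) / A) => x _; exact: (synthesis_shift_pinv_le hdot A0 AAB lo up).
Qed.
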